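(* Let $k \ge 1$ be an integer. If $G$ is a $k$-SI graph, then $G$ is bipartite.
   Context: Graphs are finite and simple. For a positive integer $k$, a graph $G$ is a $k$-stepwise irregular graph ($k$-SI graph) if $|d_G(u) - d_G(v)| = k$ for every edge $uv \in E(G)$, where $d_G(x)$ is the degree of $x$ in $G$. *)

(* Defs.v *)
(* Library: Mathematical Components. *)
From mathcomp Require Import all_boot all_order all_algebra.

Set Implicit Arguments.
Unset Strict Implicit.
Unset Printing Implicit Defensive.

Import GRing.Theory Num.Theory.

(* A finite simple graph is a finType T of vertices with a symmetric and
   irreflexive adjacency relation e. *)
Definition simple_graph (T : finType) (e : rel T) : Prop :=
  symmetric e /\ irreflexive e.

Definition degree (T : finType) (e : rel T) (x : T) : nat :=
  #|[set y | e x y]|.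

(* The difference is taken in int, since subtraction on nat is truncated. *)
Definition stepwise_irregular (T : finType) (e : rel T) (k : nat) : Prop :=
  forall u v : T, e u v ->
    (`|(degree e u)%:Z - (degree e v)%:Z| = k%:Z)%R.

Definition independent (T : finType) (e : rel T) (A : {set T}) : Prop :=
  forall u v : T, u \in A -> v \in A -> ~~ e u v.

(* The parts may be empty, so that edgeless graphs are bipartite. *)
Definition bipartite (T : finType) (e : rel T) : Prop :=
  exists X Y : {set T},
    [/\ X :|: Y = [set: T], [disjoint X & Y],
        independent e X & independent e Y].

(* Main.v *)
(* Adjacent degrees differ by exactly k, so their quotients by k differ by
   exactly 1; the parity of [degree e x %/ k] is therefore a proper
   2-colouring. *)
Require Import Defs.
From mathcomp Require Import all_boot all_order all_algebra.
From mathcomp Require Import zify.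

(** Colour each vertex by the parity of its degree's floor quotient by [k]. Moving along an edge
    shifts the degree by exactly [k], hence the quotient by exactly 1, so the colour flips
    ([stepwise_irregular_parity]). *)

Lemma stepwise_irregular_degree (T : finType) (e : rel T) (k : nat) (u v : T) :
  stepwise_irregular e k -> e u v ->
  degree e u = degree e v + k \/ degree e v = degree e u + k.
Proof. by move=> hG /hG; lia. Qed.

(** Since [k] divides the added term, the quotient grows by exactly 1 whatever the remainder of
    [m]. *)
Lemma odd_divnDr (k m : nat) : 0 < k -> odd ((m + k) %/ k) = ~~ odd (m %/ k).
Proof. by move=> k_gt0; rewrite divnDr // divnn k_gt0 addn1. Qed.

Lemma stepwise_irregular_parity (T : finType) (e : rel T) (k : nat) (u v : T) :
  0 < k -> stepwise_irregular e k -> e u v ->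
  odd (degree e u %/ k) = ~~ odd (degree e v %/ k).
Proof.
move=> k_gt0 hG euv.
(* If [v] has the larger degree, the flip lands on the right and leaves a double negation. *)
by case: (stepwise_irregular_degree _ _ _ _ _ hG euv) => ->;
  rewrite odd_divnDr // negbK.
Qed.

Theorem proposition2p1 (T : finType) (e : rel T) (k : nat)
  (he : simple_graph e) (hk : 1 <= k) (hG : stepwise_irregular e k) :
  bipartite e.
Proof.
(* With a colour class and its complement as parts, only independence needs the flip along edges. *)
pose X := [set x | odd (degree e x %/ k)].
exists X, (~: X); split.
- exact: setUCr.
- by rewrite -setI_eq0 setICr.
- move=> u v; rewrite !inE => uX vX; apply/negP => euv.
  by move: uX; rewrite (stepwise_irregular_parity _ _ _ _ _ hk hG euv) vX.
- move=> u v; rewrite !inE => uX vX; apply/negP => euv.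
  by move: uX; rewrite (stepwise_irregular_parity _ _ _ _ _ hk hG euv) vX.
Qed.
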